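(* Let $G$ be a finite group, $S$ a non-empty inverse-closed subset of $G\setminus\{1\}$, $\mathbb{F}$ a finite field, $B\le\mathbb{F}^S$ a linear code, and let $E$ be the edge set of $\mathrm{Cay}(G,S)$. Let $$A(G,S,B)=\{\sigma\in\mathrm{Aut}(G)\mid S^\sigma=S \text{ and the permutation } \sigma^S \text{ of } S \text{ induced by } \sigma \text{ lies in } \mathrm{Aut}(B)\}.$$ Then the automorphism group $\mathrm{Aut}(\mathbf{C}(G,S,B))$ of the Cayley code contains $G\rtimes A(G,S,B)$ (in its induced action on $E$). In particular, if $G\rtimes A(G,S,B)$ is transitive on $E$, then $\mathrm{Cay}(G,S)$ is normal edge-transitive and $\mathbf{C}(G,S,B)$ is symmetric.
   Context: For a finite set $X$, $\mathbb{F}^X$ is the $\mathbb{F}$-vector space of functions $f:X\to\mathbb{F}$; a linear code is a subspace $C\le\mathbb{F}^X$. $\mathrm{Aut}(C)$ is the group of all $\rho\in\mathrm{Sym}(X)$ whose induced action on $\mathbb{F}^X$ leaves $C$ invariant; $C$ is symmetric if $\mathrm{Aut}(C)$ is transitive on $X$. For a finite group $G$ and a non-empty inverse-closed subset $S\subseteq G\setminus\{1\}$, the Cayley graph $\mathrm{Cay}(G,S)$ has vertex set $G$ and edge set $E=\{\{g,sg\}\mid g\in G,\ s\in S\}$. It admits as automorphisms the elements of $G\rtimes A(G,S)$, where $A(G,S)=\{\sigma\in\mathrm{Aut}(G)\mid S^\sigma=S\}$, with $x\in G$ acting on vertices by $g\mapsto gx$ and $\sigma\in A(G,S)$ acting by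 $g\mapsto g^\sigma$; this induces an action on $E$. $\mathrm{Cay}(G,S)$ is normal edge-transitive if $G\rtimes A(G,S)$ is transitive on $E$. For a linear code $B\le\mathbb{F}^S$, the Cayley code is $$\mathbf{C}(G,S,B)=\{f\in\mathbb{F}^E\mid \text{for all } g\in G, \text{ the function } S\to\mathbb{F},\ s\mapsto f(\{g,sg\}), \text{ lies in } B\}.$$ *)

(* Defs.v *)
From HB Require Import structures.
From mathcomp Require Import all_boot all_order all_algebra all_fingroup all_field.

Set Implicit Arguments.
Unset Strict Implicit.
Unset Printing Implicit Defensive.

Import GroupScope GRing.Theory.

(* F^X is {ffun X -> F^o}: it is the regular module F^o, not F itself, that   *)
(* makes these functions an F-vector space.                                   *)

Section Codes.

Variables (F : finFieldType) (X : finType).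
Implicit Types (f : {ffun X -> F^o}) (C : {vspace {ffun X -> F^o}}).

(* The value of f^rho at x^rho is f x. *)
Definition ffun_perm f (rho : {perm X}) : {ffun X -> F^o} :=
  [ffun x => f (rho^-1 x)].

Lemma ffun_perm1 : ffun_perm^~ 1 =1 id.
Proof. by move=> f; apply/ffunP=> x; rewrite ffunE invg1 perm1. Qed.

Lemma ffun_permM f : act_morph ffun_perm f.
Proof. by move=> rho tau; apply/ffunP=> x; rewrite !ffunE invMg permM. Qed.

Canonical ffun_perm_action := TotalAction ffun_perm1 ffun_permM.

Definition code_aut C : {set {perm X}} :=
  'N([set f | f \in C] | ffun_perm_action).

Canonical code_aut_group C := [group of code_aut C].

(* This is always false when X is empty, because [transitive _, on A | _]     *)
(* requires A to be nonempty.                                                 *)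
Definition symmetric_code C : bool :=
  [transitive code_aut C, on [set: X] | 'P].

End Codes.

Section Holomorph.

Variable G : finGroupType.

Definition holomorph : finGroupType := sdprod_by [Aut [set: G]].

(* A pair u = (sigma, x) of the holomorph stands for sigma * x: it applies    *)
(* sigma first, then the right translation by x.                              *)
Definition hol_act (g : G) (u : holomorph) : G := u.1 g * u.2.

Lemma hol_Aut (u : holomorph) : u.1 \in Aut [set: G].
Proof. by case: u => [[s x] /= /setXP[]]. Qed.

Lemma hol_autM (u : holomorph) : {morph u.1 : g h / g * h}.
Proof.
move=> g h; have := hol_Aut u; rewrite inE => /andP[_ /morphicP].
by apply; rewrite inE.
Qed.

Lemma hol_act1 : hol_act^~ 1 =1 id.
Proof. by move=> g; rewrite /hol_act /= perm1 mulg1. Qed.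

Lemma hol_actM g : act_morph hol_act g.
Proof.
by move=> u v; rewrite /hol_act /= permM hol_autM mulgA.
Qed.

Canonical hol_action := TotalAction hol_act1 hol_actM.

(* The semidirect product of G by A, as a subset of the holomorph. *)
Definition hol_sdprod (A : {set {perm G}}) : {set holomorph} :=
  [set u : holomorph | u.1 \in A].

Lemma hol_sdprod_group_set (A : {group {perm G}}) : group_set (hol_sdprod A).
Proof.
apply/group_setP; split=> [|u v]; rewrite !inE /= ?group1 // => uA vA.
exact: groupM.
Qed.

Canonical hol_sdprod_group (A : {group {perm G}}) :=
  Group (hol_sdprod_group_set A).

Lemma hol_sdprodE (A : {group {perm G}}) : A \subset Aut [set: G] ->
  sdpair1 [Aut [set: G]] @* [set: G] ><| sdpair2 [Aut [set: G]] @* A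
    = hol_sdprod A.
Proof.
move=> sA.
have nA : sdpair2 [Aut [set: G]] @* A
    \subset 'N(sdpair1 [Aut [set: G]] @* [set: G]).
  exact: subset_trans (morphimS _ sA) (im_sdpair_norm _).
rewrite sdprodE //; last first.
  apply/trivgP; rewrite -(im_sdpair_TI [Aut [set: G]]).
  exact: setIS (morphimS _ sA).
rewrite -(normC nA); apply/setP=> u; rewrite inE.
apply/mulsgP/idP=> [[a x /morphimP[s Ds sa ->] /morphimP[y Dy _ ->] ->]|uA].
  by rewrite /= !val_insubd !in_setX (subsetP sA s sa) !group1 in_setT /= mulg1.
exists (sdpair2 [Aut [set: G]] u.1) (sdpair1 [Aut [set: G]] u.2).
- by rewrite mem_morphim // (subsetP sA).
- by rewrite mem_morphim ?inE.
exact: sdpairE.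
Qed.

End Holomorph.

Section CayleyGraph.

Variables (G : finGroupType) (S : {set G}).

Definition cayley_edges : {set {set G}} :=
  [set [set g; s * g] | g in [set: G], s in S].

Definition edge : finType := {e : {set G} | e \in cayley_edges}.

Lemma mem_cayley_edges (g : G) (s : {s : G | s \in S}) :
  [set g; val s * g] \in cayley_edges.
Proof. by apply/imset2P; exists g (val s); rewrite ?inE ?(valP s). Qed.

Definition cayley_edge (g : G) (s : {s : G | s \in S}) : edge :=
  Sub [set g; val s * g] (mem_cayley_edges g s).

(* The group A(G, S). *)
Definition stab_aut : {set {perm G}} := 'N_(Aut [set: G])(S | 'P).

Canonical stab_aut_group := [group of stab_aut].

Lemma stab_aut_dom : stab_aut \subset subact_dom (mem S) 'P.
Proof.
apply/subsetP=> s /setIP[_ /astabsP nS]; apply/astabsP=> x.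
by rewrite !inE nS.
Qed.

Definition stab_aut_action : action stab_aut {s : G | s \in S} :=
  ('P^? \ stab_aut_dom)%act.

Lemma hol_sdprod_edge_dom :
  hol_sdprod stab_aut \subset subact_dom (mem cayley_edges) (hol_action G)^*.
Proof.
apply/subsetP=> u; rewrite inE => /setIP[_ /astabsP nS].
rewrite inE in_setT inE; apply/subsetP=> e; rewrite !inE.
case/imset2P=> g s _ Ss ->; apply/imset2P.
exists (hol_action G g u) (u.1 s); rewrite ?inE //.
  by have := nS s; rewrite /= /aperm => ->.
by rewrite /= /setact imsetU1 imset_set1 /= /hol_act hol_autM mulgA.
Qed.

Definition edge_action : action (hol_sdprod stab_aut) edge :=
  ((hol_action G)^*^? \ hol_sdprod_edge_dom)%act.

Definition normal_edge_transitive : bool :=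
  [transitive hol_sdprod stab_aut, on [set: edge] | edge_action].

End CayleyGraph.

Section CayleyCode.

Variables (F : finFieldType) (G : finGroupType) (S : {set G}).
Variable B : {vspace {ffun {s : G | s \in S} -> F^o}}.

Definition local_word (g : G) (f : {ffun edge S -> F^o}) :
  {ffun {s : G | s \in S} -> F^o} := [ffun s => f (cayley_edge g s)].

Lemma local_word_is_linear g : linear (local_word g).
Proof. by move=> a f h; apply/ffunP=> s; rewrite !ffunE. Qed.

HB.instance Definition _ g :=
  GRing.isLinear.Build F {ffun edge S -> F^o} {ffun {s : G | s \in S} -> F^o}
    _ (local_word g) (local_word_is_linear g).

Definition cayley_code : {vspace {ffun edge S -> F^o}} :=
  (\bigcap_(g : G) (linfun (local_word g) @^-1: B))%VS.

Lemma mem_cayley_code f :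
  reflect (forall g, local_word g f \in B) (f \in cayley_code).
Proof.
rewrite memvE; apply: (iffP subv_bigcapP) => fB g.
  by have := fB g isT; rewrite -memvE -memv_preim lfunE.
by move=> _; rewrite -memvE -memv_preim lfunE /= fB.
Qed.

(* The group A(G, S, B). *)
Definition stab_code_aut : {set {perm G}} :=
  [set sigma in stab_aut S | actperm (stab_aut_action S) sigma \in code_aut B].

Lemma stab_code_autE :
  stab_code_aut = actperm (stab_aut_action S) @*^-1 code_aut B.
Proof.
by apply/setP=> sigma; apply/setIdP/morphpreP=> [[? ?] | [? ?]]; split.
Qed.

Lemma stab_code_aut_group_set : group_set stab_code_aut.
Proof. by rewrite stab_code_autE; apply: groupP. Qed.

Canonical stab_code_aut_group := Group stab_code_aut_group_set.

End CayleyCode.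

(* Main.v *)
(* An element u = (sigma, x) sends the edge {g, sg} to {g', s^sigma g'} with   *)
(* g' = g^sigma x, so moving a word f along the edges by u^-1 turns its local *)
(* word at g into the local word of f at g', moved by sigma^-1. Since         *)
(* sigma^-1 preserves B, the moved word is again in the Cayley code.          *)

Require Import Defs.
From mathcomp Require Import all_boot all_order all_algebra all_fingroup all_field.

Set Implicit Arguments.
Unset Strict Implicit.
Unset Printing Implicit Defensive.

Import GroupScope.

(** The Cayley code is cut out by one condition per vertex, all with the same [B]. By
    [local_word_actperm], an element [u] permutes these conditions along its action on vertices and
    twists each by the permutation of [S] induced by [u.1], which preserves [B]. Symmetry and normal
    edge-transitivity follow because transitivity passes to larger groups. *)

Lemma stab_code_aut_sub (F : finFieldType) (G : finGroupType) (S : {set G})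
    (B : {vspace {ffun {s : G | s \in S} -> F^o}}) :
  stab_code_aut B \subset stab_aut S.
Proof. by apply/subsetP=> s /setIdP[]. Qed.

Lemma hol_sdprodS (G : finGroupType) (A1 A2 : {set {perm G}}) :
  A1 \subset A2 -> hol_sdprod A1 \subset hol_sdprod A2.
Proof. by move=> /subsetP sA; apply/subsetP=> u; rewrite !inE => /sA. Qed.

Lemma code_autP (F : finFieldType) (X : finType)
    (C : {vspace {ffun X -> F^o}}) (rho : {perm X}) :
  reflect (forall f, f \in C -> ffun_perm f rho \in C) (rho \in code_aut C).
Proof.
apply: (iffP idP) => [/astabsP nC f fC | nC].
  by have := nC f; rewrite !inE fC.
by rewrite !inE; apply/subsetP=> f; rewrite !inE => /nC.
Qed.

Section EdgeAction.

Variables (G : finGroupType) (S : {set G}).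

Lemma val_stab_aut_action (s : {s : G | s \in S}) a :
  a \in stab_aut S -> val (stab_aut_action S s a) = a (val s).
Proof.
by move=> aA; rewrite /stab_aut_action /= val_subact (subsetP (stab_aut_dom S)).
Qed.

(** Right translation commutes with left multiplication by [s], so only the automorphism [u.1]
    changes the label of an edge, in the same way at every vertex. *)
Lemma edge_action_cayley_edge g (s : {s : G | s \in S}) u :
    u \in hol_sdprod (stab_aut S) ->
  edge_action S (cayley_edge g s) u
    = cayley_edge (hol_act g u) (stab_aut_action S s u.1).
Proof.
move=> uA; apply: val_inj.
have aA : u.1 \in stab_aut S by move: uA; rewrite inE.
rewrite /edge_action /= val_subact (subsetP (hol_sdprod_edge_dom S)) //=.
rewrite val_stab_aut_action //.
by rewrite /setact imsetU1 imset_set1 /= /hol_act hol_autM mulgA.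
Qed.

End EdgeAction.

Section CodeAut.

Variables (F : finFieldType) (G : finGroupType) (S : {set G}).
Variable B : {vspace {ffun {s : G | s \in S} -> F^o}}.

(** The inverses cancel the one in [ffun_perm], so both sides evaluate [f] at the image under [u] of
    the edge labelled [s] at [g]. *)
Lemma local_word_actperm g (f : {ffun edge S -> F^o}) u :
    u \in hol_sdprod (stab_aut S) ->
  local_word g (ffun_perm f (actperm (edge_action S) u)^-1)
    = ffun_perm (local_word (hol_act g u) f)
        (actperm (stab_aut_action S) u.1)^-1.
Proof.
move=> uA; apply/ffunP=> s; rewrite !ffunE !invgK !actpermE.
by rewrite edge_action_cayley_edge.
Qed.

Lemma actperm_hol_sdprod_sub_code_aut :
  actperm (edge_action S) @* hol_sdprod (stab_code_aut B)
    \subset code_aut (cayley_code B).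
Proof.
apply/subsetP=> rho /morphimP[u uA uB ->] {rho}.
(* Passing to the inverse permutation gives the form treated by [local_word_actperm]. *)
rewrite -groupV; apply/code_autP=> f /mem_cayley_code fC.
apply/mem_cayley_code=> g; rewrite local_word_actperm //.
suff /code_autP: (actperm (stab_aut_action S) u.1)^-1 \in code_aut B by apply.
by rewrite groupV; move: uB; rewrite inE => /setIdP[].
Qed.

End CodeAut.

Theorem mainTheorem4 (F : finFieldType) (G : finGroupType) (S : {set G})
    (hS0 : S != set0)
    (hS1 : 1%g \notin S)
    (hSV : {in S, forall s, (s^-1)%g \in S})
    (B : {vspace {ffun {s : G | s \in S} -> F^o}}) :
  (actperm (edge_action S) @* hol_sdprod (stab_code_aut B)
     \subset code_aut (cayley_code B))%g /\
  ([transitive hol_sdprod (stab_code_aut B), on [set: edge S] | edge_action S] ->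
     normal_edge_transitive S /\ symmetric_code (cayley_code B)).
Proof.
have sC := actperm_hol_sdprod_sub_code_aut B.
have sA := hol_sdprodS (stab_code_aut_sub B).
split=> // /imsetP[e _ De].
(* For both claims, the orbit of [e] under the smaller group is already all of the edges, so it
   suffices to embed it in the orbit under the larger group. *)
split; apply/imsetP; exists e; rewrite ?inE //; apply/esym/eqP;
  rewrite eqEsubset subsetT De; apply/subsetP=> _ /imsetP[u uB ->].
  by rewrite mem_orbit // (subsetP sA).
apply/imsetP; exists (actperm (edge_action S) u).
  by rewrite (subsetP sC) // mem_morphim // (subsetP sA).
by rewrite /= /aperm actpermE.
Qed.
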